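(* Let $K$ be a field, $Q$ a finite quiver with vertex set $Q_0=\{v_1,\dots,v_n\}$, $\succ$ a length admissible order on the set $\mathcal B$ of paths of $Q$, $\mathcal T$ a set of paths of length $2$ in $Q$, and $\mathcal N=\mathcal B\setminus\mathrm{tip}(\langle\mathcal T\rangle)$. Suppose $|\mathcal N|<\infty$ and let $\Lambda=KQ/I\in\mathrm{GrAlg}(\mathcal T)$. Then the Cartan matrix of $\Lambda$ is the $n\times n$ matrix $C$ whose $(i,j)$-th entry is $|v_i\mathcal N v_j|$, the number of paths from $v_i$ to $v_j$ in $\mathcal N$.
   Context: The Cartan matrix of a finite dimensional $\Lambda=KQ/I$ is the $n\times n$ matrix with $(i,j)$-th entry $\dim_K(v_i\Lambda v_j)$. $KQ$ is the path algebra, $\mathcal B$ the set of all finite directed paths in $Q$ (vertices are paths of length $0$), $\ell(p)$ the length of a path; paths are written left to right, so a path $p$ from $v$ to $w$ satisfies $vpw=p$. ''Ideal'' means two-sided ideal and $\langle X\rangle$ is the two-sided ideal generated by $X$. A length admissible order is a well-order $\succ$ on $\mathcal B$ such that for $p,q,r,s,t\in\mathcal B$: $p\succ q$ implies $pr\succ qr$ if both are nonzero; $p\succ q$ implies $sp\succ sq$ if both are nonzero; $p=rqt$ implies $p\succeq q$; and $\ell(p)>\ell(q)$ implies $p\succ q$. For nonzero $x=\sum_{p\in\mathcal B}\alpha_p p\in KQ$, $\mathrm{tip}(x)$ is the $\succ$-largest $p$ with $\alpha_p\neq 0$; for $X\subseteq KQ$, $\mathrm{tip}(X)=\{\mathrm{tip}(x):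 x\in X, x\ne 0\}$. A nonzero $x$ is uniform if $x=vxw$ for some vertices $v,w$; an element is quadratic if it is a $K$-linear combination of paths of length $2$. An ideal is graded if it is generated by length homogeneous elements. A Gröbner basis of a graded ideal $I$ is a set $\mathcal G\subseteq I$ of length homogeneous uniform elements with $\langle\mathrm{tip}(\mathcal G)\rangle=\langle \mathrm{tip}(I)\rangle$. $KQ/I$ is a strong Koszul algebra (with respect to $I$ and $\succ$) if $I$ has a Gröbner basis with respect to $\succ$ consisting of quadratic elements. Given $\mathcal T$ and $\mathcal N$ (the paths having no subpath in $\mathcal T$): $\mathcal N_2$ is the set of paths of length $2$ in $\mathcal N$; for $t\in\mathcal T$, $\mathcal N_2(t)$ is the set of $n\in\mathcal N_2$ with $t\succ n$ and $n$ having the same start vertex and the same end vertex as $t$. Put $D=\sum_{t\in\mathcal T}|\mathcal N_2(t)|$ and $\mathcal A=K^D$, with points written $X=(x_{t,n})_{t\in\mathcal T,\,n\in\mathcal N_2(t)}$. For $X\in\mathcal A$, $\mathcal G(X)=\{g_t : t\in\mathcal T\}$ with $g_t=t-\sum_{n\in\mathcal N_2(t)}x_{t,n}n$. Finally $\mathrm{GrAlg}(\mathcal T)=\{X\in\mathcal A : KQ/\langle \mathcal G(X)\rangle$ is a strong Koszul algebra with respect to $\langle\mathcal G(X)\rangle$ and $\succ\}$. One writes $KQ/I\in\mathrm{GrAlg}(\mathcal T)$ if $I=\langle\mathcal G(X)\rangle$ for some $X\in \mathrm{GrAlg}(\mathcal T)$. *)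

(* Defs.v *)
From HB Require Import structures.
From mathcomp Require Import all_boot all_order all_algebra.
From mathcomp Require Import generic_quotient ring_quotient.
From mathcomp Require Import finmap multinomials.monalg.
From mathcomp Require Import boolp classical_sets functions cardinality fsbigop.
From mathcomp Require wochoice.

Set Implicit Arguments.
Unset Strict Implicit.
Unset Printing Implicit Defensive.

Import GRing.Theory.

Local Open Scope classical_set_scope.
Local Open Scope ring_scope.
Local Open Scope quotient_scope.

(** * Quivers and paths *)

(* A finite quiver with vertex set {v_1, ..., v_n}, encoded as 'I_n. *)
Record quiver (n : nat) := Quiver {
  arrow : finType;
  asrc : arrow -> 'I_n;
  atgt : arrow -> 'I_n
}.

Section Paths.
Context {n : nat} {Q : quiver n}.

Fixpoint composable (v : 'I_n) (s : seq (arrow Q)) : bool :=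
  if s is a :: s' then (asrc a == v) && composable (atgt a) s' else true.

Definition walk_end (v : 'I_n) (s : seq (arrow Q)) : 'I_n :=
  last v (map (@atgt n Q) s).

Lemma composable_cat v s t :
  composable v (s ++ t) = composable v s && composable (walk_end v s) t.
Proof. by elim: s v => //= a s IH v; rewrite IH andbA. Qed.

Lemma walk_end_cat v s t : walk_end v (s ++ t) = walk_end (walk_end v s) t.
Proof. by rewrite /walk_end map_cat last_cat. Qed.

End Paths.

(* A path is a start vertex together with a list of composable arrows, written
   from left to right; (v, [::]) is the path of length 0 at v. *)
Record qpath (n : nat) (Q : quiver n) := QPath {
  qpath_val :> 'I_n * seq (arrow Q);
  qpath_valP : composable qpath_val.1 qpath_val.2
}.

HB.instance Definition _ n (Q : quiver n) := [isSub for @qpath_val n Q].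
HB.instance Definition _ n (Q : quiver n) := [Countable of qpath Q by <:].

Section PathOps.
Context {n : nat} {Q : quiver n}.
Implicit Types p q r : qpath Q.

Definition psrc p : 'I_n := (val p).1.
Definition ptgt p : 'I_n := walk_end (val p).1 (val p).2.
Definition plen p : nat := size (val p).2.

Definition triv_path (v : 'I_n) : qpath Q := @QPath n Q (v, [::]) isT.

(* The product p q of two paths; [None] stands for p q = 0. *)
Definition pcat p q : option (qpath Q) :=
  if ptgt p == psrc q then insub (psrc p, (val p).2 ++ (val q).2) else None.

Variant pcat_spec p q : option (qpath Q) -> Type :=
| PcatSome r of ptgt p = psrc q & psrc r = psrc p & ptgt r = ptgt q
    & (val r).2 = (val p).2 ++ (val q).2 : pcat_spec p q (Some r)
| PcatNone of ptgt p != psrc q : pcat_spec p q None.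

Lemma pcatP p q : pcat_spec p q (pcat p q).
Proof.
rewrite /pcat; case: eqP => [e|/eqP]; last exact: PcatNone.
case: insubP => [r _ rE|].
  apply: PcatSome => //; rewrite /psrc /ptgt rE //=.
  by rewrite walk_end_cat -/(ptgt p) e.
rewrite composable_cat (valP p) /= -/(ptgt p) e.
by rewrite (valP q).
Qed.

Lemma qpath_inj p q : psrc p = psrc q -> (val p).2 = (val q).2 -> p = q.
Proof.
move=> e1 e2; apply: val_inj; move: e1 e2; rewrite /psrc.
by case: (val p) (val q) => [a b] [c d] /= -> ->.
Qed.

Lemma pcatA p q r :
  obind (pcat p) (pcat q r) = obind (fun pq => pcat pq r) (pcat p q).
Proof.
case: (pcatP q r) => [qr e1 s1 t1 v1|ne1] /=;
  case: (pcatP p q) => [pq e2 s2 t2 v2|ne2] //=.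
- case: pcatP => [x ex sx tx vx|]; last by rewrite s1 e2 eqxx.
  case: pcatP => [y ey sy ty vy|]; last by rewrite t2 e1 eqxx.
  congr Some; apply: qpath_inj; first by rewrite sx sy s2.
  by rewrite vx vy v1 v2 catA.
- by case: pcatP => // x ex; rewrite ex s1 eqxx in ne2.
- by case: pcatP => // x ex; rewrite -t2 ex eqxx in ne1.
Qed.

Lemma pcat_triv_l v p : pcat (triv_path v) p = if psrc p == v then Some p else None.
Proof.
case: pcatP => [r e s t w|]; last by rewrite eq_sym => /negbTE ->.
by rewrite -e eqxx; congr Some; apply: qpath_inj; rewrite ?w ?s.
Qed.

Lemma pcat_triv_r v p : pcat p (triv_path v) = if ptgt p == v then Some p else None.
Proof.
case: pcatP => [r e s t w|/negbTE -> //].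
by rewrite e eqxx; congr Some; apply: qpath_inj => //; rewrite w cats0.
Qed.

End PathOps.

(** * The path algebra *)

Definition path_algebra (K : fieldType) (n : nat) (Q : quiver n) : Type :=
  {malg K[qpath Q]}.

HB.instance Definition _ (K : fieldType) n (Q : quiver n) :=
  GRing.Lmodule.copy (path_algebra K Q) {malg K[qpath Q]}.

Section PathAlgebra.
Context {K : fieldType} {n : nat} {Q : quiver n}.
Local Notation KQ := (path_algebra K Q).
Implicit Types (x y z : KQ) (p q r : qpath Q).

(* The path p as an element of KQ; locked, as is the product below, to keep
   unification from unfolding it. *)
Fact pa_key : unit. Proof. exact: tt. Qed.
Definition pbasis : qpath Q -> KQ := locked_with pa_key (fun p => << 1 *g p >>).

Lemma pbasisE p : pbasis p = << 1 *g p >>.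
Proof. by rewrite /pbasis unlock. Qed.

Definition coef x p : K := mcoeff p x.
Definition supp x : {fset qpath Q} := msupp x.

Definition lin_ext (V : lmodType K) (f : qpath Q -> V) x : V :=
  \sum_(p <- supp x) coef x p *: f p.

Lemma lin_extw (V : lmodType K) (f : qpath Q -> V) x (d : {fset qpath Q}) :
  (supp x `<=` d)%fset -> lin_ext f x = \sum_(p <- d) coef x p *: f p.
Proof.
move=> xd; apply: big_fset_incl => // p _ px.
by rewrite /coef (mcoeff_outdom px) scale0r.
Qed.

Lemma lin_ext_is_linear (V : lmodType K) (f : qpath Q -> V) :
  linear (lin_ext f : KQ -> V).
Proof.
move=> a x y; pose z : KQ := a *: x + y; pose d := (supp z `|` (supp x `|` supp y))%fset.
have [zd xd yd] : [/\ supp z `<=` d, supp x `<=` d & supp y `<=` d]%fset.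
  by split; apply/fsubsetP => p; rewrite !inE => ->; rewrite ?orbT.
rewrite -/z (lin_extw _ zd) (lin_extw _ xd) (lin_extw _ yd).
rewrite scaler_sumr -big_split /=; apply: eq_bigr => p _.
by rewrite /coef mcoeffD mcoeffZ scalerDl scalerA.
Qed.

HB.instance Definition _ (V : lmodType K) (f : qpath Q -> V) :=
  GRing.isLinear.Build K KQ V _ (lin_ext f) (lin_ext_is_linear f).

Lemma lin_ext_basis (V : lmodType K) (f : qpath Q -> V) p :
  lin_ext f (pbasis p) = f p.
Proof.
by rewrite pbasisE /lin_ext /supp msuppU oner_eq0 big_seq_fset1 /coef mcoeffUU
  scale1r.
Qed.

Lemma coefZ a x p : coef (a *: x) p = a * coef x p.
Proof. exact: mcoeffZ. Qed.

Lemma coef_pbasis p q : coef (pbasis p) q = (p == q)%:R.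
Proof. rewrite pbasisE; exact: mcoeffU. Qed.

Lemma monom_pbasis a p : << a *g p >> = a *: pbasis p :> KQ.
Proof.
apply/malgP => q; rewrite [LHS]mcoeffU [RHS]coefZ coef_pbasis.
by rewrite [RHS]mulr_natr.
Qed.

Lemma path_algebraE x : x = \sum_(p <- supp x) coef x p *: pbasis p.
Proof. by rewrite {1}[x]monalgE; apply: eq_bigr => p _; rewrite monom_pbasis. Qed.

Lemma lin_eq (V : lmodType K) (f g : KQ -> V) :
  linear f -> linear g -> (forall p, f (pbasis p) = g (pbasis p)) -> f =1 g.
Proof.
move=> fl gl fg x.
pose fL := GRing.isLinear.Build K KQ V _ f fl.
pose f' : {linear KQ -> V} := HB.pack f fL.
pose gL := GRing.isLinear.Build K KQ V _ g gl.
pose g' : {linear KQ -> V} := HB.pack g gL.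
rewrite (path_algebraE x).
rewrite -[f _]/(f' _) -[g _]/(g' _) !linear_sum; apply: eq_bigr => p _.
by rewrite !linearZ /= fg.
Qed.

Definition pmul p q : KQ := oapp pbasis 0 (pcat p q).

Definition pa_mul : KQ -> KQ -> KQ :=
  locked_with pa_key (fun x y => lin_ext (fun p => lin_ext (pmul p) y) x).

Lemma pa_mulE x y : pa_mul x y = lin_ext (fun p => lin_ext (pmul p) y) x.
Proof. by rewrite /pa_mul unlock. Qed.

Definition pa_one : KQ := \sum_(v < n) pbasis (triv_path v).

Lemma pa_mul_linl y : linear (pa_mul^~ y).
Proof. by move=> a x z; rewrite !pa_mulE linearP. Qed.

Lemma pa_mul_linr x : linear (pa_mul x).
Proof.
move=> a y z; rewrite !pa_mulE /lin_ext scaler_sumr -big_split /=.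
apply: eq_bigr => p _; rewrite -/(lin_ext _ _) linearP scalerDr !scalerA.
by rewrite mulrC.
Qed.

Lemma pa_mul_basis p q : pa_mul (pbasis p) (pbasis q) = pmul p q.
Proof. by rewrite pa_mulE !lin_ext_basis. Qed.

Lemma pa_mulDl : left_distributive pa_mul +%R.
Proof. by move=> x y z; have := pa_mul_linl z 1 x y; rewrite !scale1r. Qed.

Lemma pa_mulDr : right_distributive pa_mul +%R.
Proof. by move=> z x y; have := pa_mul_linr z 1 x y; rewrite !scale1r. Qed.

Lemma pa_mul0l x : pa_mul 0 x = 0.
Proof. by rewrite pa_mulE linear0. Qed.

Lemma pa_mul0r x : pa_mul x 0 = 0.
Proof. by apply: (addrI (pa_mul x 0)); rewrite -pa_mulDr !addr0. Qed.

Lemma pa_mulZl a x y : pa_mul (a *: x) y = a *: pa_mul x y.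
Proof. by rewrite !pa_mulE linearZ. Qed.

Lemma pa_mulZr a x y : pa_mul x (a *: y) = a *: pa_mul x y.
Proof.
rewrite -[in LHS](addr0 (a *: y)) pa_mul_linr pa_mul0r.
by rewrite (addr0 (a *: pa_mul x y)).
Qed.

Lemma pa_mulA : associative pa_mul.
Proof.
move=> x y z; move: x; apply: lin_eq => [a u v|a u v|p].
- exact: pa_mul_linl.
- by rewrite 2!pa_mul_linl.
move: y; apply: lin_eq => [a u v|a u v|q].
- by rewrite pa_mul_linl pa_mul_linr.
- by rewrite pa_mul_linr pa_mul_linl.
move: z; apply: lin_eq => [a u v|a u v|r].
- exact: (etrans (congr1 (pa_mul _) (pa_mul_linr _ a u v)) (pa_mul_linr _ a _ _)).
- exact: pa_mul_linr.
rewrite !pa_mul_basis /pmul; have := pcatA p q r.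
case: (pcat q r) (pcat p q) => [qr|] [pq|] /= e;
  by rewrite ?pa_mul0l ?pa_mul0r ?pa_mul_basis /pmul ?e // -e.
Qed.

Lemma pa_mul1l : left_id pa_one pa_mul.
Proof.
apply: lin_eq => [|a u v //|p]; first exact: pa_mul_linr.
rewrite (big_morph (pa_mul^~ _) (fun x y => pa_mulDl x y _) (pa_mul0l _)).
rewrite (bigD1 (psrc p)) //= big1 ?addr0 => [|v nv];
  by rewrite pa_mul_basis /pmul pcat_triv_l ?eqxx // eq_sym (negbTE nv).
Qed.

Lemma pa_mul1r : right_id pa_one pa_mul.
Proof.
apply: lin_eq => [|a u v //|p]; first exact: pa_mul_linl.
rewrite (big_morph (pa_mul _) (pa_mulDr _) (pa_mul0r _)).
rewrite (bigD1 (ptgt p)) //= big1 ?addr0 => [|v nv];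
  by rewrite pa_mul_basis /pmul pcat_triv_r ?eqxx // eq_sym (negbTE nv).
Qed.

(* The ring may be trivial, since the quiver may have no vertices. *)
HB.instance Definition _ := GRing.Zmodule_isPzRing.Build (path_algebra K Q)
  pa_mulA pa_mul1l pa_mul1r pa_mulDl pa_mulDr.

Lemma pa_scalerAl a x y : a *: (x * y) = (a *: x) * y.
Proof. by rewrite [RHS]pa_mulZl. Qed.

Lemma pa_scalerAr a x y : a *: (x * y) = x * (a *: y).
Proof. by rewrite [RHS]pa_mulZr. Qed.

Definition vtx (v : 'I_n) : KQ := pbasis (triv_path v).

End PathAlgebra.

(** * Two-sided ideals and quotients *)

HB.mixin Record isTwoSided (R : pzRingType) (S : R -> bool) := {
  two_sidedMl : forall a x, x \in S -> a * x \in S;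
  two_sidedMr : forall a x, x \in S -> x * a \in S
}.

#[short(type="ideal")]
HB.structure Definition Ideal (R : pzRingType) :=
  {S of GRing.ZmodClosed R S & isTwoSided R S}.

Definition ideal_gen_pred (R : pzRingType) (X : set R) : R -> bool :=
  fun x => `[< forall J : ideal R, (forall y, X y -> y \in J) -> x \in J >].

Section IdealGen.
Context {R : pzRingType} (X : set R).

Lemma ideal_genP x :
  x \in ideal_gen_pred X <-> forall J : ideal R,
    (forall y, X y -> y \in J) -> x \in J.
Proof. by split=> [/asboolP|H]; last exact/asboolP. Qed.

Lemma ideal_gen_zmod : zmod_closed (ideal_gen_pred X).
Proof.
split=> [|x y /ideal_genP Hx /ideal_genP Hy]; apply/ideal_genP => J XJ.
  exact: rpred0.
by apply: rpredB; [exact: Hx | exact: Hy].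
Qed.

Lemma ideal_gen_Ml a x : x \in ideal_gen_pred X -> a * x \in ideal_gen_pred X.
Proof.
by move=> /ideal_genP Hx; apply/ideal_genP => J XJ; apply: two_sidedMl; apply: Hx.
Qed.

Lemma ideal_gen_Mr a x : x \in ideal_gen_pred X -> x * a \in ideal_gen_pred X.
Proof.
by move=> /ideal_genP Hx; apply/ideal_genP => J XJ; apply: two_sidedMr; apply: Hx.
Qed.

HB.instance Definition _ := GRing.isZmodClosed.Build R (ideal_gen_pred X) ideal_gen_zmod.
HB.instance Definition _ := isTwoSided.Build R (ideal_gen_pred X) ideal_gen_Ml ideal_gen_Mr.

(* The two-sided ideal generated by X. *)
Definition ideal_gen : ideal R := Ideal.clone R (ideal_gen_pred X) _.

End IdealGen.

(* KQ/I.  The additive group is the library's quotient; the library provides the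
   ring structure only for commutative rings. *)
Definition quot_algebra (K : fieldType) n (Q : quiver n)
  (I : ideal (path_algebra K Q)) : Type := Quotient.quot I.

HB.instance Definition _ (K : fieldType) n (Q : quiver n)
  (I : ideal (path_algebra K Q)) := GRing.Zmodule.copy (quot_algebra I) (Quotient.quot I).

Section QuotAlgebra.
Context {K : fieldType} {n : nat} {Q : quiver n} {I : ideal (path_algebra K Q)}.
Local Notation KQ := (path_algebra K Q).
Local Notation L := (quot_algebra I).

Definition quot_pi (x : KQ) : L := \pi_(Quotient.quot I) x.
Definition quot_repr (x : L) : KQ := repr (x : Quotient.quot I).

Lemma quot_reprK x : quot_pi (quot_repr x) = x.
Proof. exact: reprK. Qed.

Lemma quot_piP x y : quot_pi x = quot_pi y <-> x - y \in I.
Proof.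
rewrite (_ : (x - y \in _) = (x == y %[mod Quotient.quot I])).
  by split=> [/eqP|/eqP].
exact: Quotient.idealrBE.
Qed.

Lemma quot_piB x y : quot_pi (x - y) = quot_pi x - quot_pi y.
Proof. exact: raddfB. Qed.

Lemma quot_piD x y : quot_pi (x + y) = quot_pi x + quot_pi y.
Proof. exact: raddfD. Qed.

Definition quot_one : L := quot_pi 1.
Definition quot_mul (x y : L) : L := quot_pi (quot_repr x * quot_repr y).
Definition quot_scale (a : K) (x : L) : L := quot_pi (a *: quot_repr x).

Lemma quot_piM x y : quot_pi (x * y) = quot_mul (quot_pi x) (quot_pi y).
Proof.
apply/quot_piP; set x' := quot_repr (quot_pi x); set y' := quot_repr (quot_pi y).
have -> : x * y - x' * y' = (x - x') * y + x' * (y - y').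
  by rewrite mulrBl mulrBr addrA subrK.
by apply: rpredD; [apply: two_sidedMr|apply: two_sidedMl];
  apply/quot_piP; rewrite quot_reprK.
Qed.

Lemma quot_piZ a x : quot_pi (a *: x) = quot_scale a (quot_pi x).
Proof.
apply/quot_piP; rewrite -scalerBr -[_ - _]mul1r pa_scalerAl.
by apply: two_sidedMl; apply/quot_piP; rewrite quot_reprK.
Qed.

Lemma quot_mulA : associative quot_mul.
Proof.
move=> x y z; rewrite -(quot_reprK x) -(quot_reprK y) -(quot_reprK z).
by rewrite -!quot_piM mulrA.
Qed.

Lemma quot_mul1l : left_id quot_one quot_mul.
Proof. by move=> x; rewrite -(quot_reprK x) -quot_piM mul1r. Qed.

Lemma quot_mul1r : right_id quot_one quot_mul.
Proof. by move=> x; rewrite -(quot_reprK x) -quot_piM mulr1. Qed.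

Lemma quot_mulDl : left_distributive quot_mul +%R.
Proof.
move=> x y z; rewrite -(quot_reprK x) -(quot_reprK y) -(quot_reprK z).
by rewrite -quot_piD -!quot_piM mulrDl quot_piD.
Qed.

Lemma quot_mulDr : right_distributive quot_mul +%R.
Proof.
move=> x y z; rewrite -(quot_reprK x) -(quot_reprK y) -(quot_reprK z).
by rewrite -quot_piD -!quot_piM mulrDr quot_piD.
Qed.

HB.instance Definition _ := GRing.Zmodule_isPzRing.Build (quot_algebra I)
  quot_mulA quot_mul1l quot_mul1r quot_mulDl quot_mulDr.

Lemma quot_scaleA a b x : quot_scale a (quot_scale b x) = quot_scale (a * b) x.
Proof. by rewrite -(quot_reprK x) -!quot_piZ scalerA. Qed.

Lemma quot_scale1 : left_id 1 quot_scale.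
Proof. by move=> x; rewrite -(quot_reprK x) -quot_piZ scale1r. Qed.

Lemma quot_scaleDr : right_distributive quot_scale +%R.
Proof.
move=> a x y; rewrite -(quot_reprK x) -(quot_reprK y).
by rewrite -quot_piD -!quot_piZ scalerDr quot_piD.
Qed.

Lemma quot_scaleDl x : {morph quot_scale^~ x : a b / a + b}.
Proof.
by move=> a b; rewrite -(quot_reprK x) -!quot_piZ scalerDl quot_piD.
Qed.

HB.instance Definition _ := GRing.Zmodule_isLmodule.Build K (quot_algebra I)
  quot_scaleA quot_scale1 quot_scaleDr quot_scaleDl.

End QuotAlgebra.

(** * The Cartan matrix *)

(* The subset U of V is a K-subspace of finite dimension d. *)
Definition has_dim (K : fieldType) (V : lmodType K) (U : set V) (d : nat) : Prop :=
  exists b : 'I_d -> V,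
    (forall c : 'I_d -> K, \sum_i c i *: b i = 0 -> forall i, c i = 0) /\
    U = [set \sum_i c i *: b i | c in [set: 'I_d -> K]].

Section Cartan.
Context {K : fieldType} {n : nat} {Q : quiver n}.
Variable I : ideal (path_algebra K Q).

(* v_i Lambda v_j, for Lambda = KQ/I *)
Definition peirce (i j : 'I_n) : set (quot_algebra I) :=
  [set quot_pi (vtx i) * x * quot_pi (vtx j) | x in [set: quot_algebra I]].

(* Lambda = KQ/I is finite dimensional and its Cartan matrix is C. *)
Definition is_cartan_matrix (C : 'M[nat]_n) : Prop :=
  (exists d, has_dim [set: quot_algebra I] d) /\
  forall i j, has_dim (peirce i j) (C i j).

End Cartan.

(** * Length admissible orders, tips and strong Koszul algebras *)

Section Koszul.
Context {K : fieldType} {n : nat} {Q : quiver n}.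
(* The order is given by its reflexive relation: [le p q] is p <= q, and
   [succ p q] below is the strict relation, p larger than q. *)
Variable le : rel (qpath Q).
Local Notation KQ := (path_algebra K Q).

Definition succ : rel (qpath Q) := fun p q => (p != q) && le q p.

(* [pcat p q = Some r] says that the product p q is nonzero and equal to r. *)
Definition length_admissible : Prop :=
  [/\ wochoice.well_order le,
      forall p q r pr qr, pcat p r = Some pr -> pcat q r = Some qr ->
        succ p q -> succ pr qr,
      forall p q s sp sq, pcat s p = Some sp -> pcat s q = Some sq ->
        succ p q -> succ sp sq,
      forall p r q t rq, pcat r q = Some rq -> pcat rq t = Some p -> le q p
    & forall p q, (plen q < plen p)%N -> succ p q].

Definition is_tip (x : KQ) (p : qpath Q) : Prop :=
  p \in supp x /\ forall q, q \in supp x -> q != p -> succ p q.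

Definition tips (X : set KQ) : set (qpath Q) :=
  [set p | exists2 x, X x & is_tip x p].

Definition path_ideal (P : set (qpath Q)) : ideal KQ :=
  ideal_gen [set pbasis p | p in P].

Definition uniform (x : KQ) : Prop :=
  x != 0 /\ exists v w, x = vtx v * x * vtx w.

Definition homogeneous (x : KQ) : Prop :=
  exists d, forall p, p \in supp x -> plen p = d.

Definition quadratic (x : KQ) : Prop := forall p, p \in supp x -> plen p = 2%N.

Definition graded (I : ideal KQ) : Prop :=
  exists2 X : set KQ, (forall x, X x -> homogeneous x) &
    forall x, (x \in I) = (x \in ideal_gen X).

Definition groebner_basis (I : ideal KQ) (G : set KQ) : Prop :=
  [/\ forall g, G g -> g \in I,
      forall g, G g -> homogeneous g /\ uniform g
    & forall x, (x \in path_ideal (tips G)) =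
        (x \in path_ideal (tips [set y | y \in I]))].

Definition strong_koszul (I : ideal KQ) : Prop :=
  graded I /\
  exists2 G, groebner_basis I G & forall g, G g -> quadratic g.

Variable T : set (qpath Q).

Definition nontips : set (qpath Q) :=
  ~` tips [set x | x \in path_ideal T].

Definition nontips2 : set (qpath Q) := [set p | nontips p /\ plen p = 2%N].

Definition nontips2_at (t : qpath Q) : set (qpath Q) :=
  [set p | [/\ nontips2 p, succ t p, psrc p = psrc t & ptgt p = ptgt t]].

(* The index set of the coordinates x_{t,n}; it is finite, with D elements. *)
Definition coord_index : Type :=
  {tn : qpath Q * qpath Q | `[< T tn.1 /\ nontips2_at tn.1 tn.2 >]}.

Definition affine_space : Type := coord_index -> K.

(* x_{t,n}, extended by 0 outside the index set *)
Definition coord_at (X : affine_space) (t m : qpath Q) : K := oapp X 0 (insub (t, m)).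

(* The sum is over a finite set: Q has finitely many paths of length 2. *)
Definition gpoly (X : affine_space) (t : qpath Q) : KQ :=
  pbasis t - \sum_(m \in nontips2_at t) coord_at X t m *: pbasis m.

Definition gset (X : affine_space) : set KQ := [set gpoly X t | t in T].

Definition GrAlg : set affine_space :=
  [set X | strong_koszul (ideal_gen (gset X))].

Definition in_GrAlg (I : ideal KQ) : Prop :=
  exists2 X, GrAlg X &
    forall x, (x \in I) = (x \in ideal_gen (gset X)).

End Koszul.

Arguments nontips K {n Q} le T _.
Arguments in_GrAlg {K n Q} le T I.

(* Main.v *)
Require Import Defs.
From HB Require Import structures.
From mathcomp Require Import all_boot all_algebra finmap multinomials.monalg.
From mathcomp Require Import zify.
From mathcomp Require Import boolp classical_sets cardinality fsbigop.
From mathcomp Require wochoice.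

(** The paths in N form a basis of KQ/I; since the idempotents v_i cut this
basis along start and end vertices, v_i (KQ/I) v_j has basis the paths of N from
v_i to v_j, and the Cartan matrix counts them.

Write t - r_t for the generator g_t, so that r_t is a combination of paths of N
of length 2, parallel to t and smaller than t.  A path lies in N exactly when
none of its subpaths is in T, because the ideal generated by T is spanned by
paths (nontipsE).

Spanning (nontips_span).  If p = a t b with t in T, then p is congruent modulo I
to a r_t b, a combination of smaller paths parallel to p.  As the order is
a well-order, every path is congruent to a combination of paths of N parallel to
it.

Independence (nontips_independent).  Here the Koszul hypothesis enters.  It says
that the ideal generated by tip(I) is generated by the tips of quadratic
elements of I, so it is enough to see that such tips are in T
(quadratic_tip): then the tip of every nonzero element of I has a subpath in T,
and no nonzero combination of paths of N is in I.  Let phi (reduce2) be the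
linear map that kills the paths of length at least 3, replaces t by r_t for t in
T, and fixes the other paths.  The kernel of phi is a two-sided ideal: an
element of the kernel has no component of length 0 or 1, so multiplying it by
a path of positive length lands in length at least 3, and multiplying it by a
vertex commutes with phi because r_t is parallel to t.  This kernel contains
all g_t, hence I.  On the other hand, if x is quadratic with tip p not in T,
then the coefficient of p in phi(x) is its coefficient in x, since the other
paths q of x are smaller than p and so is everything in r_q. *)

Set Implicit Arguments.
Unset Strict Implicit.
Unset Printing Implicit Defensive.

Import GRing.Theory.

Local Open Scope classical_set_scope.
Local Open Scope ring_scope.

(** * Well-orders *)

Section WellOrder.
Context (A : eqType) (R : rel A).
Hypothesis R_wo : wochoice.well_order R.

Let chain_wo : wochoice.wo_chain R predT.
Proof. by move=> B _; apply: R_wo. Qed.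

Lemma well_order_refl : reflexive R.
Proof. by move=> x; apply: (wochoice.wo_chain_reflexive chain_wo). Qed.

Lemma well_order_total : total R.
Proof. by move=> x y; apply: (wochoice.wo_chainW chain_wo). Qed.

Lemma well_order_anti : antisymmetric R.
Proof. by move=> x y; apply: (wochoice.wo_chain_antisymmetric chain_wo). Qed.

(** Transitivity is read off the minimum of {x, y, z}. *)
Lemma well_order_trans : transitive R.
Proof.
move=> y x z xy yz; have ne : wochoice.nonempty [in [:: x; y; z]].
  by exists x; rewrite !inE eqxx.
have [m [[+ m_min] _]] := R_wo ne; rewrite !inE => /or3P[] /eqP mE.
- by rewrite -mE m_min // !inE eqxx !orbT.
- suff -> : x = y by [].
  by apply: well_order_anti; rewrite xy -[X in R X x]mE m_min // !inE eqxx.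
- suff <- : y = z by [].
  by apply: well_order_anti; rewrite yz -[X in R X y]mE m_min // !inE eqxx !orbT.
Qed.

Lemma well_order_ind (P : A -> Prop) :
  (forall x, (forall y, y != x -> R y x -> P y) -> P x) -> forall x, P x.
Proof.
move=> step x0; apply: contrapT => nPx0.
have ne : wochoice.nonempty [pred x | `[< ~ P x >]] by exists x0; apply/asboolP.
have [m [[/asboolP nPm m_min] _]] := R_wo ne.
apply: nPm; apply: step => y y_m Rym; apply: contrapT => nPy.
case/eqP: y_m; apply: well_order_anti; rewrite Rym m_min //.
exact/asboolP.
Qed.

Lemma well_order_max (s : seq A) :
  s != [::] -> exists2 x, x \in s & forall y, y \in s -> R y x.
Proof.
elim: s => // a s IH _; have [->|/IH[m ms m_max]] := eqVneq s [::].
  by exists a; rewrite ?mem_head // => y; rewrite inE => /eqP->; exact: well_order_refl.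
have [am|ma] := orP (well_order_total a m).
  exists m => [|y]; first by rewrite inE ms orbT.
  by rewrite inE => /predU1P[->//|/m_max].
exists a => [|y]; first exact: mem_head.
rewrite inE => /predU1P[->|/m_max ym]; first exact: well_order_refl.
exact: well_order_trans ym ma.
Qed.

End WellOrder.

(** * Supports of elements of the path algebra *)

Section Support.
Context {K : fieldType} {n : nat} {Q : quiver n}.
Local Notation KQ := (path_algebra K Q).
Implicit Types (x y : KQ) (p q r : qpath Q).

Lemma supp_coef x p : (p \in supp x) = (coef x p != 0).
Proof. by rewrite /coef mcoeff_neq0. Qed.

Lemma pa_coef0 p : coef (0 : KQ) p = 0.
Proof. exact: mcoeff0. Qed.

Lemma pa_coefD x y p : coef (x + y) p = coef x p + coef y p.
Proof. exact: mcoeffD. Qed.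

Lemma pa_coef_sum (J : Type) (s : seq J) (P : pred J) (F : J -> KQ) p :
  coef (\sum_(i <- s | P i) F i) p = \sum_(i <- s | P i) coef (F i) p.
Proof. by elim/big_rec2: _ => [|i a b _ <-]; rewrite ?pa_coef0 ?pa_coefD. Qed.

Lemma supp_eq0 x : (forall p, p \notin supp x) -> x = 0.
Proof.
move=> x0; rewrite (path_algebraE x) big1_seq // => p /andP[_ px].
by move: (x0 p); rewrite px.
Qed.

Lemma coef_lin_ext (f : qpath Q -> KQ) x r :
  coef (lin_ext f x) r = \sum_(p <- supp x) coef x p * coef (f p) r.
Proof. by rewrite pa_coef_sum; apply: eq_bigr => p _; rewrite Defs.coefZ. Qed.

Lemma supp_lin_ext (f : qpath Q -> KQ) x r :
  r \in supp (lin_ext f x) -> exists2 p, p \in supp x & r \in supp (f p).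
Proof.
rewrite supp_coef coef_lin_ext => nz; apply: contrapT => nex.
case/eqP: nz; rewrite big1_seq // => p /andP[_ px].
have [->|fr] := eqVneq (coef (f p) r) 0; first by rewrite mulr0.
by case: nex; exists p => //; rewrite supp_coef.
Qed.

Definition supported (P : set (qpath Q)) x : Prop := forall p, p \in supp x -> P p.

Lemma supported0 P : supported P 0.
Proof. by move=> p; rewrite supp_coef pa_coef0 eqxx. Qed.

Lemma supportedZ P a x : supported P x -> supported P (a *: x).
Proof.
move=> Px p; rewrite supp_coef Defs.coefZ mulf_eq0 negb_or => /andP[_].
by rewrite -supp_coef => /Px.
Qed.

Lemma supportedD P x y : supported P x -> supported P y -> supported P (x + y).
Proof.
move=> Px Py p; rewrite supp_coef pa_coefD => nz.
have [x0|xp] := eqVneq (coef x p) 0; last by apply: Px; rewrite supp_coef.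
by apply: Py; rewrite supp_coef; rewrite x0 add0r in nz.
Qed.

Lemma supportedB P x y : supported P x -> supported P y -> supported P (x - y).
Proof. by move=> Px /(supportedZ (a := -1)); rewrite scaleN1r; exact: supportedD. Qed.

Lemma supported_sum P (J : eqType) (s : seq J) (F : J -> KQ) :
  (forall i, i \in s -> supported P (F i)) -> supported P (\sum_(i <- s) F i).
Proof.
move=> PF; rewrite big_seq; apply: (big_ind (supported P)) => //.
- exact: supported0.
- by move=> x y; exact: supportedD.
Qed.

Lemma supp_pbasis p q : (q \in supp (pbasis p : KQ)) = (p == q).
Proof. by rewrite supp_coef coef_pbasis; case: (p == q); rewrite ?oner_eq0 ?eqxx. Qed.

Lemma supported_pbasis (P : set (qpath Q)) p : P p -> supported P (pbasis p).
Proof. by move=> Pp q; rewrite supp_pbasis => /eqP <-. Qed.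

Lemma mul_lin_ext x y : x * y = lin_ext (fun p => lin_ext (pmul p) y) x.
Proof. exact: pa_mulE. Qed.

Lemma mul_pbasis p q : pbasis p * pbasis q = pmul p q :> KQ.
Proof. exact: pa_mul_basis. Qed.

(** The product of two paths is a path or 0, so cancellation can only shrink the
    set of all concatenations. *)
Lemma supp_mul x y r : r \in supp (x * y) ->
  exists p q, [/\ p \in supp x, q \in supp y & pcat p q = Some r].
Proof.
rewrite mul_lin_ext => /supp_lin_ext[p px /supp_lin_ext[q qy]].
rewrite /pmul; case E: (pcat p q) => [s|] /=; last by rewrite supp_coef pa_coef0 eqxx.
by rewrite supp_pbasis => /eqP <-; exists p, q.
Qed.

End Support.

(** * Monomial ideals *)

(** Induction on membership in a generated ideal: a property with the closure
    properties of an ideal defines one, which then contains the generated ideal. *)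
Lemma ideal_gen_sub (R : pzRingType) (X : set R) (P : R -> Prop) :
    P 0 -> (forall x y, P x -> P y -> P (x - y)) ->
    (forall a x, P x -> P (a * x)) -> (forall a x, P x -> P (x * a)) ->
    (forall x, X x -> P x) ->
  forall x, x \in ideal_gen X -> P x.
Proof.
move=> P0 PB Pl Pr XP x /ideal_genP xX.
pose S : R -> bool := fun y => `[< P y >].
have SP y : (y \in S) = `[< P y >] by [].
have Szmod : zmod_closed S.
  split=> [|y z]; rewrite !SP; first exact/asboolP.
  by move=> /asboolP Py /asboolP Pz; apply/asboolP; exact: PB.
have Sl a y : y \in S -> a * y \in S.
  by rewrite !SP => /asboolP Py; apply/asboolP; exact: Pl.
have Sr a y : y \in S -> y * a \in S.
  by rewrite !SP => /asboolP Py; apply/asboolP; exact: Pr.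
pose SZ := GRing.isZmodClosed.Build R S Szmod.
pose ST := isTwoSided.Build R S Sl Sr.
pose J : ideal R := HB.pack S SZ ST.
by apply/asboolP; apply: (xX J) => y /XP Py; apply/asboolP.
Qed.

Lemma mem_ideal_gen (R : pzRingType) (X : set R) x : X x -> x \in ideal_gen X.
Proof. by move=> Xx; apply/ideal_genP => J; apply. Qed.

Section Monomial.
Context {n : nat} {Q : quiver n}.
Implicit Types (p q r t : qpath Q) (T : set (qpath Q)).

Definition has_factor T p : Prop :=
  exists2 t, T t & exists a b at_, pcat a t = Some at_ /\ pcat at_ b = Some p.

(** With has_factor_catl, this makes the elements supported on paths with
    a factor in T a two-sided ideal. *)
Lemma has_factor_catr T p c r :
  has_factor T p -> pcat p c = Some r -> has_factor T r.
Proof.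
move=> [t Tt [a [b [at_ [aE bE]]]]] cE; exists t => //.
have := pcatA at_ b c; rewrite bE /= cE.
case E: (pcat b c) => [bc|] //= bcE.
by exists a, bc, at_.
Qed.

Lemma has_factor_catl T p c r :
  has_factor T p -> pcat c p = Some r -> has_factor T r.
Proof.
move=> [t Tt [a [b [at_ [aE bE]]]]] cE; exists t => //.
have := pcatA c at_ b; rewrite bE /= cE.
case E: (pcat c at_) => [cat|] //= catE.
have := pcatA c a t; rewrite aE /= E.
case E': (pcat c a) => [ca|] //= caE.
by exists ca, b, cat.
Qed.

Lemma has_factor_mem T t : T t -> has_factor T t.
Proof.
move=> Tt; exists t => //; exists (triv_path (psrc t)), (triv_path (ptgt t)), t.
by rewrite pcat_triv_l pcat_triv_r !eqxx.
Qed.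

Lemma path_ideal_supported (K : fieldType) T (x : path_algebra K Q) :
  x \in path_ideal T -> supported (has_factor T) x.
Proof.
move: x; apply: ideal_gen_sub => [|x y|a x Px r|a x Px r|x [p Tp <-]].
- exact: supported0.
- exact: supportedB.
- by case/supp_mul => p [q [_ /Px Pq]]; exact: has_factor_catl.
- by case/supp_mul => p [q [/Px Pp _]]; exact: has_factor_catr.
- by apply: supported_pbasis; exact: has_factor_mem.
Qed.

Lemma path_ideal_mono (K : fieldType) (S T : set (qpath Q)) (x : path_algebra K Q) :
  S `<=` T -> x \in path_ideal S -> x \in path_ideal T.
Proof.
move=> ST /ideal_genP xS; apply/ideal_genP => J TJ; apply: xS => _ [p Sp <-].
by apply: TJ; exists p => //; exact: ST.
Qed.

End Monomial.

(** * Multiplying by a path on both sides *)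

Section Sandwich.
Context {K : fieldType} {n : nat} {Q : quiver n}.
Local Notation KQ := (path_algebra K Q).
Implicit Types (x y : KQ) (a b p q r : qpath Q).

Definition sandwich a r b : option (qpath Q) := obind (pcat^~ b) (pcat a r).

(** Two uses: end points show that replacing r by a parallel path gives
    a parallel product, and lengths show that products with a path of positive
    length leave the low degrees. *)
Variant sandwich_spec a r b : option (qpath Q) -> Prop :=
| SandwichSome s of psrc s = psrc a & ptgt s = ptgt b
    & plen s = (plen a + plen r + plen b)%N : sandwich_spec a r b (Some s)
| SandwichNone : sandwich_spec a r b None.

Lemma sandwichP a r b : sandwich_spec a r b (sandwich a r b).
Proof.
rewrite /sandwich; case: pcatP => [s e1 s1 t1 v1|_] /=; last by constructor.
case: pcatP => [u e2 s2 t2 v2|_]; last by constructor.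
by constructor; rewrite ?s2 // /plen v2 v1 !size_cat.
Qed.

Lemma sandwich_triv v w r :
  sandwich (triv_path v) r (triv_path w)
    = if (psrc r == v) && (ptgt r == w) then Some r else None.
Proof.
by rewrite /sandwich pcat_triv_l; case: eqP => //= _; rewrite pcat_triv_r.
Qed.

Lemma mul_pbasis3 a r b :
  pbasis a * pbasis r * pbasis b = oapp pbasis 0 (sandwich a r b) :> KQ.
Proof.
rewrite mul_pbasis /pmul /sandwich; case: (pcat a r) => [s|] /=.
  by rewrite mul_pbasis.
exact: mul0r.
Qed.

Lemma mul3_sum a b (J : Type) (s : seq J) (c : J -> K) (F : J -> KQ) :
  pbasis a * (\sum_(i <- s) c i *: F i) * pbasis b
    = \sum_(i <- s) c i *: (pbasis a * F i * pbasis b).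
Proof.
rewrite mulr_sumr mulr_suml; apply: eq_bigr => i _.
by rewrite -pa_scalerAr -pa_scalerAl.
Qed.

Lemma mul_sandwich a x b :
  pbasis a * x * pbasis b
    = \sum_(r <- supp x) coef x r *: oapp pbasis 0 (sandwich a r b).
Proof.
rewrite {1}(path_algebraE x) mul3_sum; apply: eq_bigr => r _.
by rewrite mul_pbasis3.
Qed.

Definition parallel p : set (qpath Q) :=
  [set q | psrc q = psrc p /\ ptgt q = ptgt p].

(** Uniformity of the remainders enters through this lemma: vertices act on an
    element supported on paths parallel to p as they act on p. *)
Lemma mul_vtx_parallel v w p x : supported (parallel p) x ->
  vtx v * x * vtx w = if (psrc p == v) && (ptgt p == w) then x else 0.
Proof.
move=> xp; rewrite /vtx mul_sandwich.
rewrite (eq_big_seq (fun r => if (psrc p == v) && (ptgt p == w)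
  then coef x r *: pbasis r else 0)) => [|r /xp[sr tr]]; last first.
  by rewrite sandwich_triv sr tr; case: ifP; rewrite ?scaler0.
by case: ifP => _; [rewrite -path_algebraE | rewrite big1].
Qed.

Lemma coef_lin_ext_id (f : qpath Q -> KQ) x q :
    (forall p, p \in supp x -> coef (f p) q = coef (pbasis p : KQ) q) ->
  coef (lin_ext f x) q = coef x q.
Proof.
move=> fq; rewrite coef_lin_ext [in RHS](path_algebraE x) pa_coef_sum.
by apply: eq_big_seq => p /fq ->; rewrite Defs.coefZ.
Qed.

End Sandwich.

(** * Tips *)

Section Tips.
Context {K : fieldType} {n : nat} {Q : quiver n} (le : rel (qpath Q)).
Local Notation KQ := (path_algebra K Q).
Hypothesis le_wo : wochoice.well_order le.

Lemma succ_asym p q : succ le p q -> succ le q p -> False.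
Proof.
move=> /andP[/eqP pq qp] /andP[_ pq']; apply: pq.
by apply: (well_order_anti le_wo); rewrite pq'.
Qed.

Lemma is_tip_pbasis p : is_tip le (pbasis p : KQ) p.
Proof.
by split=> [|q]; rewrite supp_pbasis // => /eqP ->; rewrite eqxx.
Qed.

Lemma tip_exists (x : KQ) : x != 0 -> exists p, is_tip le x p.
Proof.
move=> x0; have sx : enum_fset (supp x) != [::].
  apply: contra_neq x0 => sx; apply: supp_eq0 => p.
  by rewrite -[p \in _]/(p \in enum_fset (supp x)) sx.
have [p px p_max] := well_order_max le_wo sx.
by exists p; split=> // q qx qp; rewrite /succ eq_sym qp p_max.
Qed.

(** Tips of a monomial ideal are paths of that ideal, and these are the paths
    with a factor in T. *)
Lemma nontipsE (T : set (qpath Q)) p : nontips K le T p <-> ~ has_factor T p.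
Proof.
split=> [nt [t Tt [a [b [at_ [aE bE]]]]]|nf [x xT [px _]]].
  apply: nt; exists (pbasis p); last exact: is_tip_pbasis.
  have -> : pbasis p = pbasis a * pbasis t * pbasis b :> KQ.
    by rewrite mul_pbasis3 /sandwich aE /= bE.
  apply: two_sidedMr; apply: two_sidedMl; apply: mem_ideal_gen.
  by exists t.
exact/nf/(path_ideal_supported xT).
Qed.

End Tips.

(** * Quadratic reduction *)

Section Reduction.
Context {K : fieldType} {n : nat} {Q : quiver n} (le : rel (qpath Q)).
Local Notation KQ := (path_algebra K Q).
Hypothesis le_adm : length_admissible le.
Variable T : set (qpath Q).
Hypothesis T2 : forall t, T t -> plen t = 2%N.
Variable X : @affine_space K n Q le T.
Implicit Types (x y : KQ) (a b p q r s t : qpath Q).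

Let le_wo : wochoice.well_order le. Proof. by case: le_adm. Qed.

Local Notation I0 := (ideal_gen (gset X)).

Definition remainder t : KQ := pbasis t - gpoly X t.

Lemma remainder_supported t : supported (@nontips2_at K n Q le T t) (remainder t).
Proof.
rewrite /remainder /gpoly opprB addrC subrK; apply: supported_sum => m.
case: finite_supportP => // Y YN _ _ mY; apply: supportedZ.
by apply: supported_pbasis; apply: YN.
Qed.

(** The map phi, on paths: reduction modulo the g_t in length 2, and truncation
    above length 2.  The truncation is what makes the kernel an ideal, as
    reduction in length 2 alone does not commute with multiplication by arrows. *)
Definition reduce2_path p : KQ :=
  if (2 < plen p)%N then 0 else if `[< T p >] then remainder p else pbasis p.

Definition reduce2 : KQ -> KQ := lin_ext reduce2_path.

Lemma reduce2_path_parallel p : supported (parallel p) (reduce2_path p).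
Proof.
rewrite /reduce2_path; case: ifP => _; first exact: supported0.
by case: asboolP => [_ q /remainder_supported[]|_]; last exact: supported_pbasis.
Qed.

(** Vertices commute with the reduction.  If one of a, b has positive length,
    then r with a r b of length at most 2 has length at most 1; the reduction
    fixes such r and no other path is reduced onto it, so the coefficient of r
    in x is its coefficient in the reduction of x, which is 0. *)
Lemma reduce2_sandwich a b x :
  reduce2 x = 0 -> reduce2 (pbasis a * x * pbasis b) = 0.
Proof.
move=> x0; rewrite mul_sandwich /reduce2 linear_sum.
have [ab0|ab1] := posnP (plen a + plen b).
  have [aE bE] : a = triv_path (psrc a) /\ b = triv_path (psrc b).
    move/eqP: ab0; rewrite addn_eq0 => /andP[/nilP a0 /nilP b0].
    by split; apply: qpath_inj.
  (* Both outer factors are vertices, and they commute with the reduction. *)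
  transitivity (vtx (psrc a) * reduce2 x * vtx (psrc b)); last first.
    by rewrite x0 mulr0 mul0r.
  rewrite /reduce2 /lin_ext mul3_sum; apply: eq_bigr => r _.
  rewrite linearZ /= aE bE sandwich_triv.
  rewrite (@mul_vtx_parallel _ _ _ _ _ r) => [|q /reduce2_path_parallel//].
  by case: ifP => _ /=; rewrite ?linear0 ?lin_ext_basis.
apply: big1_seq => r /andP[_ rx].
rewrite linearZ /=.
case: sandwichP => [s _ _ sE|] /=; last by rewrite linear0 scaler0.
rewrite lin_ext_basis /reduce2_path sE.
case: ltnP => [_|r2]; first exact: scaler0.
have {}r2 : (plen r < 2)%N by lia.
(* As r has length 0 or 1, the reduction fixes it and maps no other path onto it;
   its coefficient in x is therefore 0. *)
have : coef (reduce2 x) r = coef x r.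
  apply: coef_lin_ext_id => p px; rewrite /reduce2_path.
  case: ltnP => [p2|_].
    rewrite pa_coef0 coef_pbasis; case: eqP => // pr.
    by rewrite pr ltnNge ltnW in p2.
  case: asboolP => // Tp; rewrite coef_pbasis.
  case: eqP => [pr|_]; first by rewrite -pr T2 in r2.
  apply/eqP; rewrite -[_ == _]negbK -supp_coef; apply/negP.
  by move=> /remainder_supported[[_ r2'] _ _ _]; rewrite r2' in r2.
by rewrite x0 pa_coef0 => rx0; move: rx; rewrite supp_coef -rx0 eqxx.
Qed.

Lemma reduce2_mul x (a b : KQ) : reduce2 x = 0 -> reduce2 (a * x * b) = 0.
Proof.
move=> x0; rewrite (path_algebraE a) (path_algebraE b).
rewrite !mulr_suml /reduce2 linear_sum; apply: big1_seq => p _.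
rewrite mulr_sumr linear_sum; apply: big1_seq => q _.
rewrite -!pa_scalerAl -pa_scalerAr !linearZ /=.
by rewrite -[lin_ext _ _]/(reduce2 _) reduce2_sandwich // !scaler0.
Qed.

Lemma nontips_notin m : nontips K le T m -> ~ T m.
Proof. by move=> /nontipsE nm Tm; apply: nm; exact: has_factor_mem. Qed.

(** The remainder of t is a combination of paths of N, so it is fixed by the
    reduction: one step of rewriting is enough. *)
Lemma reduce2_gpoly t : T t -> reduce2 (gpoly X t) = 0.
Proof.
move=> Tt; have -> : gpoly X t = pbasis t - remainder t.
  by rewrite /remainder opprB addrC subrK.
rewrite /reduce2 linearB /= lin_ext_basis /reduce2_path T2 // asboolT //=.
apply/eqP; rewrite subr_eq0 eq_sym {2}(path_algebraE (remainder t)).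
apply/eqP; apply: eq_big_seq => m /remainder_supported[[nm m2] _ _ _].
by rewrite m2 /= asboolF //; apply: nontips_notin.
Qed.

Lemma ideal_reduce2 x : x \in I0 -> reduce2 x = 0.
Proof.
move: x; apply: ideal_gen_sub => [|x y x0 y0|a x x0|a x x0|x [t Tt <-]].
- exact: linear0.
- by rewrite /reduce2 linearB /= -!/(reduce2 _) x0 y0 subrr.
- by rewrite -[a * x]mulr1 reduce2_mul.
- by rewrite -[x]mul1r reduce2_mul.
- exact: reduce2_gpoly.
Qed.

(** A path q of x other than its tip p is smaller than p, and replacing q by its
    remainder only gives still smaller paths: if p were not in T, then p would
    survive in the reduction of x, which is 0. *)
Lemma quadratic_tip x p : x \in I0 -> quadratic x -> is_tip le x p -> T p.
Proof.
move=> /ideal_reduce2 x0 x2 [px p_max]; apply: contrapT => nTp.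
have : coef (reduce2 x) p = coef x p.
  apply: coef_lin_ext_id => q qx; rewrite /reduce2_path x2 //=.
  case: asboolP => // Tq; rewrite coef_pbasis.
  case: eqP => [qp|/eqP qp]; first by case: nTp; rewrite -qp.
  apply/eqP; rewrite -[_ == _]negbK -supp_coef; apply/negP.
  move=> /remainder_supported[_ qp' _ _].
  exact: (succ_asym le_wo qp' (p_max q qx qp)).
by rewrite x0 pa_coef0 => /esym/eqP; apply/negP; rewrite -supp_coef.
Qed.

Hypothesis koszul : strong_koszul le I0.

(** The tip of a nonzero x in I is in the ideal generated by the tips of
    a quadratic Groebner basis, hence in the ideal generated by T, so it has
    a factor in T. *)
Lemma nontips_independent x :
  x \in I0 -> supported (nontips K le T) x -> x = 0.
Proof.
move=> xI xN; apply: contrapT => /eqP /(tip_exists le_wo)[p ptip].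
have [_ [G [GI _ GE] G2]] := koszul.
have /nontipsE : nontips K le T p by apply: xN; case: ptip.
apply; have : (pbasis p : KQ) \in path_ideal T.
  apply: (@path_ideal_mono _ _ _ (tips le G)).
    by move=> q [g Gg gtip]; apply: (quadratic_tip (GI g Gg)) => //; exact: G2.
  by rewrite GE; apply: mem_ideal_gen; exists p => //; exists x.
by move/path_ideal_supported; apply; rewrite supp_pbasis.
Qed.

End Reduction.

(** * Normal forms *)

Section NormalForm.
Context {K : fieldType} {n : nat} {Q : quiver n}.
Local Notation KQ := (path_algebra K Q).
Variable I : ideal KQ.
Implicit Types (x y z : KQ) (p q : qpath Q) (P R : set (qpath Q)).

Definition congr_supported P z : Prop := exists2 y, z - y \in I & supported P y.

Lemma congr_supported0 P : congr_supported P 0.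
Proof. by exists 0; [rewrite subrr rpred0|exact: supported0]. Qed.

Lemma congr_supportedD P x y :
  congr_supported P x -> congr_supported P y -> congr_supported P (x + y).
Proof.
move=> [x' xI xP] [y' yI yP]; exists (x' + y'); last exact: supportedD.
by rewrite opprD addrACA rpredD.
Qed.

Lemma congr_supportedZ P c x : congr_supported P x -> congr_supported P (c *: x).
Proof.
move=> [x' xI xP]; exists (c *: x'); last exact: supportedZ.
by rewrite -scalerBr -[_ - _]mul1r pa_scalerAl two_sidedMl.
Qed.

Lemma congr_supported_sum P (J : eqType) (s : seq J) (c : J -> K) (F : J -> KQ) :
    (forall i, i \in s -> congr_supported P (F i)) ->
  congr_supported P (\sum_(i <- s) c i *: F i).
Proof.
move=> PF; rewrite big_seq; apply: (big_ind (congr_supported P)) => //.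
- exact: congr_supported0.
- by move=> x y; exact: congr_supportedD.
- by move=> i /PF; exact: congr_supportedZ.
Qed.

Lemma congr_supported_congr P x y :
  x - y \in I -> congr_supported P y -> congr_supported P x.
Proof.
move=> xy [z yz zP]; exists z => //.
by rewrite -[x](subrK y) -addrA rpredD.
Qed.

End NormalForm.

Section Spanning.
Context {K : fieldType} {n : nat} {Q : quiver n} (le : rel (qpath Q)).
Local Notation KQ := (path_algebra K Q).
Hypothesis le_adm : length_admissible le.
Variables (T : set (qpath Q)) (X : @affine_space K n Q le T).

Definition normal_at p : set (qpath Q) := [set q | nontips K le T q /\ parallel p q].

(** Well-founded rewriting a t b -> a r_t b.  Multiplication on either side
    preserves the order, so each step goes down. *)
Lemma nontips_span p :
  congr_supported (ideal_gen (gset X)) (normal_at p) (pbasis p).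
Proof.
have [le_wo le_l le_r _ _] := le_adm.
elim/(well_order_ind le_wo): p => p IH.
have [|/contrapT] := EM (~ has_factor T p).
  move=> /(@nontipsE K _ _ le) np; exists (pbasis p); first by rewrite subrr rpred0.
  exact: supported_pbasis.
move=> [t Tt [a [b [at_ [aE bE]]]]].
have pE : sandwich a t b = Some p by rewrite /sandwich aE.
apply: (@congr_supported_congr _ _ _ _ _ _ (pbasis a * remainder X t * pbasis b)).
  have -> : pbasis p = pbasis a * pbasis t * pbasis b :> KQ.
    by rewrite mul_pbasis3 pE.
  rewrite -mulrBl -mulrBr /remainder opprB addrC subrK.
  by apply: two_sidedMr; apply: two_sidedMl; apply: mem_ideal_gen; exists t.
rewrite mul_sandwich; apply: congr_supported_sum => m.
move=> /remainder_supported[_ tm sm tm'].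
case E: (sandwich a m b) => [s|] /=; last exact: congr_supported0.
have [ps sp] : succ le p s /\ parallel p s.
  split; last first.
    by move: pE E; case: sandwichP => // ? s1 t1 _ [<-];
      case: sandwichP => // ? s2 t2 _ [<-]; rewrite /parallel /= s1 t1 s2 t2.
  move: E; rewrite /sandwich; case amE: (pcat a m) => [am|] //= sE.
  exact: (le_l _ _ _ _ _ bE sE (le_r _ _ _ _ _ aE amE tm)).
have [p_s les] := andP ps; rewrite eq_sym in p_s.
have [y sy yN] := IH s p_s les.
exists y => // q /yN[nq [sq tq]].
by case: sp => s1 s2; split; rewrite // /parallel /= sq tq.
Qed.

End Spanning.

(** * Dimensions *)

Section Dimension.
Context {K : fieldType} {n : nat} {Q : quiver n}.
Local Notation KQ := (path_algebra K Q).
Variable I : ideal KQ.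

Lemma quot_pi_eq0 (x : KQ) : (quot_pi x = 0 :> quot_algebra I) <-> x \in I.
Proof.
have -> : 0 = quot_pi 0 :> quot_algebra I.
  by have := @quot_piB K n Q I 0 0; rewrite !subrr.
by rewrite quot_piP subr0.
Qed.

Lemma quot_pi_mul (x y : KQ) :
  quot_pi (x * y) = quot_pi x * quot_pi y :> quot_algebra I.
Proof. exact: quot_piM. Qed.

Lemma quot_pi_sum (J : finType) (c : J -> K) (F : J -> KQ) :
  quot_pi (\sum_i c i *: F i) = \sum_i c i *: quot_pi (F i) :> quot_algebra I.
Proof.
rewrite (big_morph _ (@quot_piD K n Q I) (id1 := 0)); last first.
  by apply/quot_pi_eq0; exact: rpred0.
by apply: eq_bigr => i _; exact: quot_piZ.
Qed.

(** The projection is injective on the span of S, which meets I only in 0, so it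
    carries the basis S of this span to a basis of the image. *)
Lemma has_dim_paths (S : {fset qpath Q}) :
    (forall x : KQ, x \in I -> supported [set` S] x -> x = 0) ->
  has_dim [set (quot_pi x : quot_algebra I) | x in supported [set` S]] #|` S|.
Proof.
move=> indep; pose s := in_tuple (enum_fset S).
have s_inj : injective (tnth s) by apply/tuple_uniqP; exact: fset_uniq.
have Ss i : tnth s i \in S by exact: mem_tnth.
have Sc (c : 'I_#|` S| -> K) :
    supported [set` S] (\sum_i c i *: (pbasis (tnth s i) : KQ)).
  by apply: supported_sum => i _; apply: supportedZ; apply: supported_pbasis; exact: Ss.
exists (fun i => quot_pi (pbasis (tnth s i))); split=> [c|].
  rewrite -quot_pi_sum => /quot_pi_eq0 /indep /(_ (Sc c)) c0 i.
  have := congr1 (fun x : KQ => coef x (tnth s i)) c0.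
  rewrite pa_coef0 pa_coef_sum (bigD1 i) //= big1 => [|j ji].
    by rewrite addr0 Defs.coefZ coef_pbasis eqxx mulr1.
  rewrite Defs.coefZ coef_pbasis; case: eqP => [/eqP|_]; last by rewrite mulr0.
  by rewrite (inj_eq s_inj) (negbTE ji).
rewrite predeqE => u; split=> [[x xS <-]|[c _ <-]]; last first.
  by exists (\sum_i c i *: pbasis (tnth s i)); rewrite ?quot_pi_sum.
exists (fun i => coef x (tnth s i)) => //; rewrite -quot_pi_sum; congr quot_pi.
rewrite -(big_tnth _ _ (enum_fset S) xpredT (fun p => coef x p *: pbasis p)).
rewrite [RHS](path_algebraE x); symmetry; apply: big_fset_incl.
  by apply/fsubsetP => p /xS.
by move=> p _; rewrite supp_coef negbK => /eqP ->; rewrite scale0r.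
Qed.

End Dimension.

(** * The Cartan matrix *)

Theorem corollary4p5 (K : fieldType) (n : nat) (Q : quiver n)
    (le : rel (qpath Q)) (le_adm : length_admissible le)
    (T : set (qpath Q)) (T2 : forall t, T t -> plen t = 2%N)
    (N_fin : finite_set (nontips K le T))
    (I : ideal (path_algebra K Q)) (I_gr : in_GrAlg le T I) :
  is_cartan_matrix I
    (\matrix_(i, j) #|` fset_set [set p | [/\ nontips K le T p,
                                             psrc p = i & ptgt p = j]]|).
Proof.
case: I_gr => X X_gr IE.
have indep (A : set (qpath Q)) : finite_set A -> A `<=` nontips K le T ->
    forall x, x \in I -> supported [set` fset_set A] x -> x = 0.
  move=> Af AN x xI xA; apply: (nontips_independent le_adm T2 X_gr).
    by rewrite -IE.
  by move=> p /xA /=; rewrite in_fset_set // inE => /AN.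
have span p : congr_supported I (normal_at (K := K) le T p) (pbasis p).
  by have [y yI yN] := nontips_span le_adm X p; exists y; rewrite ?IE.
split=> [|i j].
  exists #|` fset_set (nontips K le T)|.
  rewrite (_ : [set: _] =
    [set quot_pi x | x in supported [set` fset_set (nontips K le T)]]).
    by apply: has_dim_paths; apply: indep.
  apply/seteqP; split=> // u _; rewrite -(quot_reprK u).
  have : congr_supported I (nontips K le T) (quot_repr u).
    rewrite (path_algebraE (quot_repr u)); apply: congr_supported_sum => p _.
    by have [y py yN] := span p; exists y => // q /yN[].
  move=> [y uy yN]; exists y; last by apply/esym/quot_piP.
  by rewrite fset_setK.
rewrite mxE; set N := [set p | _].
have NN : N `<=` nontips K le T by move=> p [].
have Nfin : finite_set N by exact: sub_finite_set N_fin.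
rewrite (_ : peirce i j = [set quot_pi x | x in supported [set` fset_set N]]).
  by apply: has_dim_paths; apply: indep.
rewrite fset_setK //; apply/seteqP; split=> [_ [u _ <-]|_ [x xN <-]].
  rewrite -(quot_reprK u) -!quot_pi_mul.
  have : congr_supported I N (vtx i * quot_repr u * vtx j).
    rewrite /vtx mul_sandwich; apply: congr_supported_sum => p _.
    rewrite sandwich_triv; case: andP => [[/eqP si /eqP tj]|_] /=; last first.
      exact: congr_supported0.
    have [y py yN] := span p; exists y => // q /yN[nq [sq tq]].
    by split; rewrite ?sq ?tq.
  by move=> [y uy yN]; exists y => //; apply/esym/quot_piP.
exists (quot_pi x) => //; rewrite -!quot_pi_mul; congr quot_pi.
rewrite /vtx mul_sandwich [RHS](path_algebraE x); apply: eq_big_seq => p /xN[_ pi pj].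
by rewrite sandwich_triv pi pj !eqxx.
Qed.
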